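(* Let $C\subset S^{D-1}$ and $Y\subset S^{k-1}$ be kissing configurations, with $Y$ containing distinct antipodal pairs $\{\pm u_i\}$, $1\le i\le t$. Choose $B_i\subseteq C$ and, for each $x\in B_i$, heights $h_{i,x}^+,h_{i,x}^-$ with $0<h_{i,x}^+,h_{i,x}^-<1$. In $\mathbb{R}^D\oplus\mathbb{R}^k$ retain the points $(x,0)$ with $x\in C\setminus\bigcup_iB_i$, retain all points $(0,y)$ with $y\in Y$, and insert, for all $1\le i\le t$ and $x\in B_i$, the two points $$\left(\sqrt{1-(h_{i,x}^{+})^2}\,x,\ h_{i,x}^{+}u_i\right),\qquad\left(\sqrt{1-(h_{i,x}^{-})^2}\,x,\ -h_{i,x}^{-}u_i\right).$$ The resulting set is a kissing configuration if and only if every height $h_{i,x}^{\pm}$ equals $1/2$, the sets $B_i$ are pairwise disjoint, and distinct elements of each $B_i$ have inner product at most $1/3$.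
   Context: A kissing configuration in $S^{n-1}\subset\mathbb{R}^n$ is a set of unit vectors whose distinct members have inner product at most $\tfrac12$. *)

(* Defs.v *)
From mathcomp Require Import all_boot all_order all_algebra.
From mathcomp Require Import boolp classical_sets reals.

Set Implicit Arguments.
Unset Strict Implicit.
Unset Printing Implicit Defensive.

Import Order.TTheory GRing.Theory Num.Theory.

Local Open Scope classical_set_scope.
Local Open Scope ring_scope.

Section Kissing.
Context {R : realType}.

Definition dotv {n} (u v : 'rV[R]_n) : R := \sum_(j < n) u 0 j * v 0 j.

(* The norm that MathComp-Analysis puts on row vectors is the sup norm, so the
   Euclidean one is defined here. *)
Definition enorm {n} (u : 'rV[R]_n) : R := Num.sqrt (dotv u u).

(* The sphere S^{n-1} of R^n. *)
Definition unit_sphere {n} : set 'rV[R]_n := [set x | enorm x = 1].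

Definition kissing {n} (A : set 'rV[R]_n) : Prop :=
  A `<=` unit_sphere /\
  forall x y, A x -> A y -> x <> y -> dotv x y <= 1 / 2.

(* R^D (+) R^k is 'rV[R]_(D + k), with (x, y) encoded as row_mx x y.  Only the
   values of hp i and hm i on B i matter. *)
Definition lifted_configuration {D k t} (C : set 'rV[R]_D) (Y : set 'rV[R]_k)
    (u : 'I_t -> 'rV[R]_k) (B : 'I_t -> set 'rV[R]_D)
    (hp hm : 'I_t -> 'rV[R]_D -> R) : set 'rV[R]_(D + k) :=
  [set row_mx x 0 | x in C `\` \bigcup_i B i]
  `|` [set row_mx 0 y | y in Y]
  `|` \bigcup_i
        [set row_mx (Num.sqrt (1 - hp i x ^+ 2) *: x) (hp i x *: u i)
        | x in B i]
  `|` \bigcup_i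
        [set row_mx (Num.sqrt (1 - hm i x ^+ 2) *: x) (- hm i x *: u i)
        | x in B i].

End Kissing.

(* Main.v *)
(** The inserted point over [(i, x)] with sign [+] has inner product [h] with
    [(0, u_i)], so every height is at most 1/2.  The two points inserted over
    the same [x] then have inner product
    [sqrt(1 - h^2) * sqrt(1 - h'^2) - h * h' >= 3/4 - 1/4 = 1/2], with equality
    only at [h = h' = 1/2].  Once all heights are 1/2, the point over [x]
    towards [v] and the point over [y] towards [w] have inner product
    [3/4 <x, y> + 1/4 <v, w>], and [|<u_i, u_j>| <= 1/2] for [i <> j]; the
    conditions on the [B_i] can be read off from this formula. *)

Require Import Defs.
From mathcomp Require Import all_boot all_order all_algebra.
From mathcomp Require Import boolp classical_sets reals.
From mathcomp Require Import lra.

Import Order.TTheory GRing.Theory Num.Theory.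

Local Open Scope classical_set_scope.
Local Open Scope ring_scope.

(** * Inner products of row vectors *)

Section DotProduct.
Set Implicit Arguments.
Unset Strict Implicit.
Context {R : realType}.

Lemma dotvC {n} (a b : 'rV[R]_n) : dotv a b = dotv b a.
Proof. by apply: eq_bigr => j _; rewrite mulrC. Qed.

Lemma dotvZl {n} c (a b : 'rV[R]_n) : dotv (c *: a) b = c * dotv a b.
Proof. by rewrite /dotv mulr_sumr; apply: eq_bigr => j _; rewrite mxE mulrA. Qed.

Lemma dotvZr {n} c (a b : 'rV[R]_n) : dotv a (c *: b) = c * dotv a b.
Proof. by rewrite dotvC dotvZl dotvC. Qed.

Lemma dotvNl {n} (a b : 'rV[R]_n) : dotv (- a) b = - dotv a b.
Proof. by rewrite -scaleN1r dotvZl mulN1r. Qed.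

Lemma dotvNr {n} (a b : 'rV[R]_n) : dotv a (- b) = - dotv a b.
Proof. by rewrite dotvC dotvNl dotvC. Qed.

Lemma dotv0 {n} (a : 'rV[R]_n) : dotv a 0 = 0.
Proof. by rewrite -(scale0r 0) dotvZr mul0r. Qed.

Lemma dot0v {n} (a : 'rV[R]_n) : dotv 0 a = 0.
Proof. by rewrite dotvC dotv0. Qed.

Lemma dotv_row_mx {m n} (a c : 'rV[R]_m) (b d : 'rV[R]_n) :
  dotv (row_mx a b) (row_mx c d) = dotv a c + dotv b d.
Proof.
rewrite /dotv big_split_ord /=; congr (_ + _); apply: eq_bigr => j _.
- by rewrite !row_mxEl.
- by rewrite !row_mxEr.
Qed.

Lemma unit_sphereE {n} (a : 'rV[R]_n) : unit_sphere a <-> dotv a a = 1.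
Proof.
rewrite /unit_sphere /enorm /=; split=> [a1|->]; last exact: sqrtr1.
have aa_ge0 : 0 <= dotv a a by apply: sumr_ge0 => j _; rewrite -expr2 sqr_ge0.
by rewrite -(sqr_sqrtr aa_ge0) a1 expr1n.
Qed.

(** A unit vector has inner product 1 with itself, so an inner product below 1 certifies
    distinctness; numerical bounds thus replace disequalities of points. *)
Lemma kissing_lt1 {n} (A : set 'rV[R]_n) a b :
  kissing A -> A a -> A b -> dotv a b < 1 -> dotv a b <= 1 / 2.
Proof.
move=> [A1 Ale] Aa Ab ab_lt1; apply: Ale => // eq_ab; subst b.
by move/A1/unit_sphereE: Aa ab_lt1 => ->; rewrite ltxx.
Qed.

End DotProduct.

(** * Points raised towards a direction *)

Section Lifting.
Set Implicit Arguments.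
Unset Strict Implicit.
Context {R : realType} {D k : nat}.

(** The sign is absorbed into [v], taken as [u i] or [- u i], so one formula covers both inserted
    families. *)
Definition lifted_point (h : R) (x : 'rV[R]_D) (v : 'rV[R]_k) :
    'rV[R]_(D + k) :=
  row_mx (Num.sqrt (1 - h ^+ 2) *: x) (h *: v).

Lemma dotv_lifted_point h g x y v w :
  dotv (lifted_point h x v) (lifted_point g y w) =
  Num.sqrt (1 - h ^+ 2) * Num.sqrt (1 - g ^+ 2) * dotv x y
  + h * g * dotv v w.
Proof. by rewrite dotv_row_mx !dotvZl !dotvZr !mulrA. Qed.

Lemma dotv_lifted_half x y v w :
  dotv (lifted_point (1 / 2) x v) (lifted_point (1 / 2) y w) =
  3 / 4 * dotv x y + 1 / 4 * dotv v w.
Proof.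
rewrite dotv_lifted_point -expr2 sqr_sqrtr; last by lra.
by congr (_ * _ + _ * _); lra.
Qed.

Lemma dotv_lifted_up h x v y :
  dotv (lifted_point h x v) (row_mx 0 y) = h * dotv v y.
Proof. by rewrite dotv_row_mx dotv0 add0r dotvZl. Qed.

Lemma dotv_lifted_base h x v y :
  dotv (lifted_point h x v) (row_mx y 0) = Num.sqrt (1 - h ^+ 2) * dotv x y.
Proof. by rewrite dotv_row_mx dotv0 addr0 dotvZl. Qed.

Lemma heights_eq_half (h g : R) : 0 < h <= 1 / 2 -> 0 < g <= 1 / 2 ->
  Num.sqrt (1 - h ^+ 2) * Num.sqrt (1 - g ^+ 2) - h * g <= 1 / 2 ->
  h = 1 / 2 /\ g = 1 / 2.
Proof.
move=> /andP[h0 h1] /andP[g0 g1].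
have hb : 0 <= 1 - h ^+ 2 by nra.
have gb : 0 <= 1 - g ^+ 2 by nra.
have := sqr_sqrtr hb; have := sqr_sqrtr gb.
have := sqrtr_ge0 (1 - h ^+ 2); have := sqrtr_ge0 (1 - g ^+ 2).
move: (Num.sqrt _) (Num.sqrt _) => r s r0 s0 r2 s2 le_sr.
have sr0 : 0 <= s * r by exact: mulr_ge0.
have : (s * r) ^+ 2 <= (1 / 2 + h * g) ^+ 2.
  by rewrite ler_sqr ?nnegrE; nra.
rewrite exprMn s2 r2 => le_sqr.
(* In [le_sqr] the terms $h^2g^2$ cancel, leaving $h^2+hg+g^2\ge 3/4$, while $h^2,g^2\le 1/4$. *)
have hg : 1 / 4 <= h * g by nra.
by split; nra.
Qed.

End Lifting.

(** * The configuration and its signed directions *)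

Section Configuration.
Set Implicit Arguments.
Unset Strict Implicit.
Context {R : realType} {D k t : nat}.
Variables (C : set 'rV[R]_D) (Y : set 'rV[R]_k) (u : 'I_t -> 'rV[R]_k).
Variables (B : 'I_t -> set 'rV[R]_D) (hp hm : 'I_t -> 'rV[R]_D -> R).
Hypothesis kissC : kissing C.
Hypothesis kissY : kissing Y.
Hypothesis uY : forall i, Y (u i) /\ Y (- u i).
Hypothesis u_distinct :
  forall i j, i <> j -> [set u i; - u i] <> [set u j; - u j].
Hypothesis BC : forall i, B i `<=` C.

Let L := lifted_configuration C Y u B hp hm.

Lemma lifted_configuration_up y : Y y -> L (row_mx 0 y).
Proof. by move=> Yy; left; left; right; exists y. Qed.

Lemma lifted_configuration_plus i x :
  B i x -> L (lifted_point (hp i x) x (u i)).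
Proof. by move=> Bx; left; right; exists i => //; exists x. Qed.

Lemma lifted_configuration_minus i x :
  B i x -> L (lifted_point (hm i x) x (- u i)).
Proof.
move=> Bx; right; exists i => //; exists x => //.
by rewrite /lifted_point scalerN scaleNr.
Qed.

Lemma dotC1 x : C x -> dotv x x = 1.
Proof. by move=> Cx; apply/unit_sphereE/kissC.1. Qed.

Lemma dotY1 y : Y y -> dotv y y = 1.
Proof. by move=> Yy; apply/unit_sphereE/kissY.1. Qed.

(** Instead of Cauchy-Schwarz: the product is 1 on the diagonal and at most 1/2 off it. *)
Lemma dotY_le1 y z : Y y -> Y z -> dotv y z <= 1.
Proof.
move=> Yy Yz; have [->|/eqP neq_yz] := eqVneq y z; first by rewrite dotY1.
by have := kissY.2 _ _ Yy Yz neq_yz; lra.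
Qed.

Lemma signed_inY i v : v = u i \/ v = - u i -> Y v.
Proof. by have [Yu YNu] := uY i; case=> ->. Qed.

(** Either member of an antipodal pair determines the pair, so a common member would identify the
    pairs of [i] and [j]. *)
Lemma signed_neq i j v w : i <> j ->
  v = u i \/ v = - u i -> w = u j \/ w = - u j -> v <> w.
Proof.
move=> neq_ij vE wE eq_vw; apply: (u_distinct neq_ij).
have pairE (a b : 'rV[R]_k) : a = b \/ a = - b -> [set b; - b] = [set a; - a].
  by case=> ->; rewrite ?opprK // setUC.
by rewrite (pairE _ _ vE) (pairE _ _ wE) eq_vw.
Qed.

Lemma dot_signed_le i j v w : i <> j ->
  v = u i \/ v = - u i -> w = u j \/ w = - u j -> dotv v w <= 1 / 2.
Proof.
move=> neq_ij vE wE.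
exact: kissY.2 _ _ (signed_inY vE) (signed_inY wE) (signed_neq neq_ij vE wE).
Qed.

(** * Constraints forced by the kissing property *)

Section Necessity.
Hypothesis hp_bounds : forall i x, B i x -> 0 < hp i x < 1.
Hypothesis hm_bounds : forall i x, B i x -> 0 < hm i x < 1.
Hypothesis kissL : kissing L.

Lemma height_le h x v : 0 < h < 1 -> Y v -> L (lifted_point h x v) ->
  0 < h <= 1 / 2.
Proof.
move=> /andP[-> h1] Yv Lp /=.
have := kissing_lt1 kissL Lp (lifted_configuration_up Yv).
by rewrite dotv_lifted_up dotY1 // mulr1; apply.
Qed.

Lemma kissing_heights i x : B i x -> hp i x = 1 / 2 /\ hm i x = 1 / 2.
Proof.
move=> Bx; have [Yu YNu] := uY i.
have Lp := lifted_configuration_plus Bx.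
have Lm := lifted_configuration_minus Bx.
have hp2 := height_le (hp_bounds Bx) Yu Lp.
have hm2 := height_le (hm_bounds Bx) YNu Lm.
apply: heights_eq_half => //.
have /andP[p0 _] := hp2; have /andP[m0 _] := hm2.
have := kissing_lt1 kissL Lp Lm.
rewrite dotv_lifted_point dotvNr dotY1 // dotC1; last exact: BC Bx.
rewrite mulr1 mulrN1; apply.
(* It remains to see that the inner product is below 1: the roots are at most 1 and the subtracted
   product of heights is positive. *)
have sqrt_le1 (h : R) : Num.sqrt (1 - h ^+ 2) <= 1.
  by rewrite -[leRHS]sqrtr1 ler_wsqrtr // gerBl sqr_ge0.
have : Num.sqrt (1 - hp i x ^+ 2) * Num.sqrt (1 - hm i x ^+ 2) <= 1.
  by rewrite mulr_ile1 ?sqrtr_ge0.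
by have := mulr_gt0 p0 m0; lra.
Qed.

Lemma lifted_half_in i x : B i x -> L (lifted_point (1 / 2) x (u i)).
Proof.
by move=> Bx; rewrite -(kissing_heights Bx).1; apply: lifted_configuration_plus.
Qed.

Lemma kissing_trivIset : trivIset setT B.
Proof.
move=> i j _ _ [x [Bix Bjx]]; apply: contrapT => neq_ij.
have := kissing_lt1 kissL (lifted_half_in Bix) (lifted_half_in Bjx).
rewrite dotv_lifted_half dotC1; last exact: BC Bix.
(* Both signs of [u j] are used: $3/4+\langle u_i,u_j\rangle/4$ lies in $[5/8,7/8]$, below 1 so that
   the points differ, yet above 1/2. *)
have := dot_signed_le neq_ij (or_introl erefl) (or_introl erefl).
have := dot_signed_le neq_ij (or_introl erefl) (or_intror erefl).
by rewrite dotvNr; lra.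
Qed.

Lemma kissing_dot_le_third i x y : B i x -> B i y -> x <> y ->
  dotv x y <= 1 / 3.
Proof.
move=> Bx By neq_xy; have xy := kissC.2 _ _ (BC Bx) (BC By) neq_xy.
have := kissing_lt1 kissL (lifted_half_in Bx) (lifted_half_in By).
(* With the common direction [u i] the inner product is $3/4\,\langle x,y\rangle+1/4$, at most
   $5/8<1$ by [xy]. *)
by rewrite dotv_lifted_half dotY1; [lra | have [] := uY i].
Qed.

End Necessity.

(** * Checking all pairs of points *)

Section Sufficiency.
Hypothesis heights : forall i x, B i x -> hp i x = 1 / 2 /\ hm i x = 1 / 2.
Hypothesis disjB : trivIset setT B.
Hypothesis dotB : forall i x y, B i x -> B i y -> x <> y -> dotv x y <= 1 / 3.

Variant lifted_spec : 'rV[R]_(D + k) -> Prop :=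
| LiftedBase x of C x & (forall i, ~ B i x) : lifted_spec (row_mx x 0)
| LiftedUp y of Y y : lifted_spec (row_mx 0 y)
| LiftedPoint i x v of B i x & v = u i \/ v = - u i :
    lifted_spec (lifted_point (1 / 2) x v).

Lemma lifted_configurationP p : L p -> lifted_spec p.
Proof.
case=> [[[[x [Cx notB] <-]|[y Yy <-]]|[i _ [x Bx <-]]]|[i _ [x Bx <-]]].
- by apply: LiftedBase => // i Bx; apply: notB; exists i.
- exact: LiftedUp.
- by rewrite (heights Bx).1; apply: (LiftedPoint Bx); left.
- rewrite (heights Bx).2 scaleNr -scalerN.
  by apply: (LiftedPoint Bx); right.
Qed.

Lemma dot_lifted_base_le x (v : 'rV[R]_k) y : C x -> C y -> x <> y ->
  dotv (lifted_point (1 / 2) x v) (row_mx y 0) <= 1 / 2.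
Proof.
move=> Cx Cy neq_xy; rewrite dotv_lifted_base.
have := kissC.2 _ _ Cx Cy neq_xy.
have := sqrtr_ge0 (1 - (1 / 2) ^+ 2 : R).
have : Num.sqrt (1 - (1 / 2) ^+ 2 : R) <= 1.
  by rewrite -[leRHS]sqrtr1 ler_wsqrtr // gerBl sqr_ge0.
(* A factor in $[0,1]$ preserves the bound 1/2 even for a negative inner product. *)
by move: (Num.sqrt _) => s; nra.
Qed.

Lemma dot_lifted_up_le (x : 'rV[R]_D) v y : Y v -> Y y ->
  dotv (lifted_point (1 / 2) x v) (row_mx 0 y) <= 1 / 2.
Proof. by move=> Yv Yy; rewrite dotv_lifted_up; have := dotY_le1 Yv Yy; lra. Qed.

Lemma dot_lifted_lifted_le i j x y v w : B i x -> B j y ->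
  v = u i \/ v = - u i -> w = u j \/ w = - u j ->
  lifted_point (1 / 2) x v <> lifted_point (1 / 2) y w ->
  dotv (lifted_point (1 / 2) x v) (lifted_point (1 / 2) y w) <= 1 / 2.
Proof.
move=> Bx By vE wE; rewrite dotv_lifted_half.
(* Each case has extremal value exactly 1/2: $3/8+1/8$ for [i <> j], $1/4+1/4$ for [i = j] and
   [x <> y], and $3/4-1/4$ over a single [x]. *)
have [eq_ij|/eqP neq_ij] := eqVneq i j; last first.
  have neq_xy : x <> y.
    move=> eq_xy; apply: neq_ij; apply: disjB => //.
    by exists x; split=> //; rewrite eq_xy.
  have := kissC.2 _ _ (BC Bx) (BC By) neq_xy.
  by have := dot_signed_le neq_ij vE wE; lra.
subst j; have [eq_xy|/eqP neq_xy] := eqVneq x y; last first.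
  have := dotB Bx By neq_xy.
  by have := dotY_le1 (signed_inY vE) (signed_inY wE); lra.
subst y; rewrite (dotC1 (BC Bx)).
have uu := dotY1 (uY i).1.
(* Equal signs would make the two points coincide; only opposite signs survive. *)
by case: vE wE => -> [] -> // _; rewrite ?dotvNl ?dotvNr uu; lra.
Qed.

Lemma kissing_lifted : kissing L.
Proof.
split=> [p /lifted_configurationP[x Cx _|y Yy|i x v Bx vE]|p q].
- by apply/unit_sphereE; rewrite dotv_row_mx dotv0 addr0 dotC1.
- by apply/unit_sphereE; rewrite dotv_row_mx dotv0 add0r dotY1.
- apply/unit_sphereE; rewrite dotv_lifted_half (dotC1 (BC Bx)).
  by rewrite (dotY1 (signed_inY vE)); lra.
(* Retained points of [C] lie outside every [B i], so none sits under an inserted point. *)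
have neqB x i y : (forall i, ~ B i x) -> B i y -> y <> x.
  by move=> notB By eq_yx; apply: (notB i); rewrite -eq_yx.
move=> /lifted_configurationP[x Cx xB|y Yy|i x v Bx vE]
       /lifted_configurationP[x' Cx' xB'|y' Yy'|j x' w Bx' wE] neq_pq.
- rewrite dotv_row_mx dotv0 addr0; apply: kissC.2 => // eq_x.
  by apply: neq_pq; rewrite eq_x.
- by rewrite dotv_row_mx dotv0 dot0v; lra.
- by rewrite dotvC; apply: dot_lifted_base_le (BC Bx') Cx (neqB _ _ _ xB Bx').
- by rewrite dotv_row_mx dotv0 dot0v; lra.
- rewrite dotv_row_mx dotv0 add0r; apply: kissY.2 => // eq_y.
  by apply: neq_pq; rewrite eq_y.
- by rewrite dotvC; apply: dot_lifted_up_le (signed_inY wE) Yy.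
- exact: dot_lifted_base_le (BC Bx) Cx' (neqB _ _ _ xB' Bx).
- exact: dot_lifted_up_le (signed_inY vE) Yy'.
- exact: dot_lifted_lifted_le Bx Bx' vE wE neq_pq.
Qed.

End Sufficiency.
End Configuration.

Theorem proposition8p1 (R : realType) (D k t : nat)
    (C : set 'rV[R]_D) (Y : set 'rV[R]_k)
    (kissC : kissing C) (kissY : kissing Y)
    (u : 'I_t -> 'rV[R]_k)
    (uY : forall i, Y (u i) /\ Y (- u i))
    (u_distinct : forall i j, i <> j ->
       [set u i; - u i] <> [set u j; - u j])
    (B : 'I_t -> set 'rV[R]_D)
    (BC : forall i, B i `<=` C)
    (hp hm : 'I_t -> 'rV[R]_D -> R)
    (hp_bounds : forall i x, B i x -> 0 < hp i x < 1)
    (hm_bounds : forall i x, B i x -> 0 < hm i x < 1) :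
  kissing (lifted_configuration C Y u B hp hm) <->
  [/\ forall i x, B i x -> hp i x = 1 / 2 /\ hm i x = 1 / 2,
      trivIset setT B
    & forall i x y, B i x -> B i y -> x <> y -> dotv x y <= 1 / 3].
Proof.
split=> [kissL|[heights disjB dotB]]; last exact: kissing_lifted.
split.
- exact: kissing_heights kissL.
- exact: kissing_trivIset kissL.
- exact: kissing_dot_le_third kissL.
Qed.
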